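(* Let $f\in\mathcal{F}^A_{c_1}(\mathbb{R}^n)$ and $g\in\mathcal{F}^B_{c_2}(\mathbb{R}^m)$ with $c_1,c_2\ge 0$. If ADMM (with a given step length $t>0$) is linearly convergent with respect to the dual objective value, then $D$ satisfies the Polyak-Łojasiewicz (PŁ) inequality.
   Context: Problem: $\min_{(x,z)\in\mathbb{R}^n\times\mathbb{R}^m} f(x)+g(z)$ subject to $Ax+Bz=b$, where $f:\mathbb{R}^n\to\mathbb{R}\cup\{\infty\}$ and $g:\mathbb{R}^m\to\mathbb{R}\cup\{\infty\}$ are closed proper convex functions, $0\neq A\in\mathbb{R}^{r\times n}$, $0\neq B\in\mathbb{R}^{r\times m}$, $b\in\mathbb{R}^r$. The dual objective is $D(\lambda)=\min_{(x,z)} f(x)+g(z)+\langle\lambda,Ax+Bz-b\rangle$ (value $-\infty$ if unbounded below). Equivalently $D(\lambda)=-\langle\lambda,b\rangle-f^*(-A^T\lambda)-g^*(-B^T\lambda)$, with $f^*,g^*$ the convex conjugates. Standing assumptions: $(x^\star,z^\star)$ is an optimal solution of the problem with corresponding Lagrange multiplier $\lambda^\star$ (a maximizer of $D$); strong duality holds, i.e. $\max_{\lambda} D(\lambda)=\min_{Ax+Bz=b} f(x)+g(z)$; each subproblem of ADMM attains its minimum. ADMM with step length $t>0$ and starting points $\lambda^0,z^0$: for $k=1,2,\dots$, 1. $x^{k}\in\operatorname{argmin}_x f(x)+\langle\lambda^{k-1},Ax\rangle+\tfrac{t}{2}\|Ax+Bz^{k-1}-b\|^2$; 2. $z^{k}\in\operatorname{argmin}_z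 g(z)+\langle\lambda^{k-1},Bz\rangle+\tfrac{t}{2}\|Ax^k+Bz-b\|^2$; 3. $\lambda^k=\lambda^{k-1}+t(Ax^k+Bz^k-b)$. Linear convergence with respect to the dual objective value: there is $\gamma\in[0,1)$ such that for all starting points $(\lambda^0,z^0)$ and every sequence generated by ADMM from them, $D(\lambda^\star)-D(\lambda^{k+1})\leq\gamma\,(D(\lambda^\star)-D(\lambda^k))$ for all $k\ge 1$. PŁ inequality: $D$ satisfies the PŁ inequality if there is $L_p>0$ such that for every $\lambda\in\mathbb{R}^r$ and every $\xi\in b-A\,\partial f^*(-A^T\lambda)-B\,\partial g^*(-B^T\lambda)$ one has $D(\lambda^\star)-D(\lambda)\leq\tfrac{1}{2L_p}\|\xi\|^2$. Notation: $\|x\|_A=\|Ax\|$, $\|z\|_B=\|Bz\|$ with $\|\cdot\|$ Euclidean. $\mathcal{F}^A_{c}(\mathbb{R}^n)$ is the set of closed proper functions $f$ on $\mathbb{R}^n$ with $f-\tfrac{c}{2}\|\cdot\|_A^2$ convex; $\mathcal{F}^B_c(\mathbb{R}^m)$ is defined likewise with $B$. *)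

(* Defs.v *)
From mathcomp Require Export all_boot all_order all_algebra.
From mathcomp Require Export all_classical all_reals all_analysis.

Set Implicit Arguments.
Unset Strict Implicit.
Unset Printing Implicit Defensive.

Export Order.TTheory GRing.Theory Num.Theory.
Export numFieldNormedType.Exports.

#[global] Open Scope classical_set_scope.
#[global] Open Scope ring_scope.

Section Convex_analysis.
Context {R : realType}.

Definition dotv {n : nat} (u v : 'cV[R]_n) : R := \sum_i u i 0 * v i 0.

(* Euclidean norm; the library norm on matrices is the sup norm. *)
Definition enorm {n : nat} (u : 'cV[R]_n) : R := Num.sqrt (dotv u u).

Definition enorm_mx {r n : nat} (A : 'M[R]_(r, n)) (x : 'cV[R]_n) : R :=
  enorm (A *m x).

Definition epigraph {n : nat} (f : 'cV[R]_n -> \bar R) : set ('cV[R]_n * R) :=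
  [set p | (f p.1 <= p.2%:E)%E].

Definition closed_fun {n : nat} (f : 'cV[R]_n -> \bar R) : Prop :=
  closed (epigraph f).

Definition convex_fun {n : nat} (f : 'cV[R]_n -> \bar R) : Prop :=
  convex_set (epigraph f).

Definition proper_fun {n : nat} (f : 'cV[R]_n -> \bar R) : Prop :=
  (forall x, (-oo < f x)%E) /\ (exists x, (f x < +oo)%E).

(* The class F^A_c(R^n). *)
Definition F_class {r n : nat} (A : 'M[R]_(r, n)) (c : R)
    (f : 'cV[R]_n -> \bar R) : Prop :=
  [/\ closed_fun f, proper_fun f &
      convex_fun (fun x => f x - (c / 2 * enorm_mx A x ^+ 2)%:E)%E].

Definition conjugate {n : nat} (f : 'cV[R]_n -> \bar R) (y : 'cV[R]_n) :
    \bar R :=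
  ereal_sup [set ((dotv y x)%:E - f x)%E | x in setT].

(* Only meant for functions that are not identically +oo: then it is empty at
   points where h takes the value +oo. *)
Definition subdifferential {n : nat} (h : 'cV[R]_n -> \bar R) (y : 'cV[R]_n) :
    set 'cV[R]_n :=
  [set x | forall w, (h y + (dotv x (w - y))%:E <= h w)%E].

Definition argmin {T : Type} (h : T -> \bar R) : set T :=
  [set x | forall y, (h x <= h y)%E].

End Convex_analysis.

Section ADMM.
Context {R : realType} {n m r : nat}.
Context (f : 'cV[R]_n -> \bar R) (g : 'cV[R]_m -> \bar R).
Context (A : 'M[R]_(r, n)) (B : 'M[R]_(r, m)) (b : 'cV[R]_r).

Definition feasible (x : 'cV[R]_n) (z : 'cV[R]_m) : Prop :=
  A *m x + B *m z = b.

Definition optimal_solution (x : 'cV[R]_n) (z : 'cV[R]_m) : Prop :=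
  feasible x z /\ forall x' z', feasible x' z' -> (f x + g z <= f x' + g z')%E.

Definition dual (l : 'cV[R]_r) : \bar R :=
  ereal_inf [set (f p.1 + g p.2 +
                  (dotv l (A *m p.1 + B *m p.2 - b))%:E)%E | p in setT].

Definition dual_maximizer (l : 'cV[R]_r) : Prop :=
  forall l', (dual l' <= dual l)%E.

Definition x_objective (t : R) (l : 'cV[R]_r) (z : 'cV[R]_m) (x : 'cV[R]_n) :
    \bar R :=
  (f x + (dotv l (A *m x))%:E
     + (t / 2 * enorm (A *m x + B *m z - b) ^+ 2)%:E)%E.

Definition z_objective (t : R) (l : 'cV[R]_r) (x : 'cV[R]_n) (z : 'cV[R]_m) :
    \bar R :=
  (g z + (dotv l (B *m z))%:E
     + (t / 2 * enorm (A *m x + B *m z - b) ^+ 2)%:E)%E.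

(* The second subproblem is only ever posed at a minimizer x of the first. *)
Definition subproblems_attained (t : R) : Prop :=
  (forall l z, argmin (x_objective t l z) !=set0) /\
  (forall l z x, argmin (x_objective t l z) x ->
     argmin (z_objective t l x) !=set0).

(* The starting points are lam 0 and z 0; the value x 0 is irrelevant. *)
Definition ADMM_sequence (t : R) (x : nat -> 'cV[R]_n) (z : nat -> 'cV[R]_m)
    (lam : nat -> 'cV[R]_r) : Prop :=
  forall k,
    [/\ argmin (x_objective t (lam k) (z k)) (x k.+1),
        argmin (z_objective t (lam k) (x k.+1)) (z k.+1) &
        lam k.+1 = lam k + t *: (A *m x k.+1 + B *m z k.+1 - b)].

(* Here lstar is a maximizer of the dual.  The dual may be -oo at an iterate;
   the product gamma * +oo is then +oo for gamma > 0 and 0 for gamma = 0, and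
   the latter convention does not matter because gamma is existentially
   quantified and can be increased. *)
Definition dual_linear_convergence (t : R) (lstar : 'cV[R]_r) : Prop :=
  exists gamma : R, [/\ 0 <= gamma, gamma < 1 &
    forall x z lam, ADMM_sequence t x z lam ->
      forall k : nat, (1 <= k)%N ->
        (dual lstar - dual (lam k.+1) <=
           gamma%:E * (dual lstar - dual (lam k)))%E].

(* The set b - A (subdifferential of f^* at -A^T l)
           - B (subdifferential of g^* at -B^T l). *)
Definition dual_slopes (l : 'cV[R]_r) : set 'cV[R]_r :=
  [set b - A *m x - B *m z |
     x in subdifferential (conjugate f) (- (A^T *m l)) &
     z in subdifferential (conjugate g) (- (B^T *m l))].

Definition PL_inequality (lstar : 'cV[R]_r) : Prop :=
  exists2 Lp : R, 0 < Lp &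
    forall l xi, dual_slopes l xi ->
      (dual lstar - dual l <= (1 / (2 * Lp) * enorm xi ^+ 2)%:E)%E.

End ADMM.

(* Main.v *)
Require Import Defs.
From mathcomp Require Import ring lra.

Set Implicit Arguments.
Unset Strict Implicit.
Unset Printing Implicit Defensive.

(** If [xi = b - A x - B z] is a dual slope at [l], then ADMM started at
    [(l + t xi, z)] reproduces [A x], [B z] and [l] in its first iteration.
    In the second iteration, monotonicity of the subdifferentials of [f] and [g]
    bounds [|lam 2 - lam 1|] by [t |xi|], while concavity of the dual gives
    [D(lam 2) - D(lam 1) <= - <xi, lam 2 - lam 1> <= t |xi|^2].  Linear
    convergence turns this into
    [(1 - gamma) (D(lstar) - D(l)) <= t |xi|^2]. *)

(** * Euclidean inner product *)

Section Dot_product.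
Context {R : realType} {n : nat}.
Implicit Types u v w : 'cV[R]_n.

Lemma dotvC u v : dotv u v = dotv v u.
Proof. by apply: eq_bigr => i _; rewrite mulrC. Qed.

Lemma dotvDl u v w : dotv (u + v) w = dotv u w + dotv v w.
Proof.
by rewrite /dotv -big_split; apply: eq_bigr => i _; rewrite !mxE mulrDl.
Qed.

Lemma dotvDr u v w : dotv w (u + v) = dotv w u + dotv w v.
Proof. by rewrite dotvC dotvDl !(dotvC w). Qed.

Lemma dotvZl (s : R) u v : dotv (s *: u) v = s * dotv u v.
Proof.
by rewrite /dotv mulr_sumr; apply: eq_bigr => i _; rewrite !mxE mulrA.
Qed.

Lemma dotvZr (s : R) u v : dotv u (s *: v) = s * dotv u v.
Proof. by rewrite dotvC dotvZl dotvC. Qed.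

Lemma dotvNl u v : dotv (- u) v = - dotv u v.
Proof. by rewrite -scaleN1r dotvZl mulN1r. Qed.

Lemma dotvNr u v : dotv u (- v) = - dotv u v.
Proof. by rewrite dotvC dotvNl dotvC. Qed.

Definition dotv_linE := (dotvDl, dotvDr, dotvZl, dotvZr, dotvNl, dotvNr).

Lemma dotvv_ge0 u : 0 <= dotv u u.
Proof. by apply: sumr_ge0 => i _; rewrite -expr2 sqr_ge0. Qed.

Lemma dotvv_le0 u : dotv u u <= 0 -> u = 0.
Proof.
move=> u_le0; have /eqP : dotv u u = 0.
  by apply/le_anti; rewrite u_le0 dotvv_ge0.
rewrite psumr_eq0 => [/allP u0|i _]; last by rewrite -expr2 sqr_ge0.
apply/colP => i; rewrite mxE; apply/eqP.
by move: (u0 i (mem_index_enum i)); rewrite /= mulf_eq0 orbb.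
Qed.

Lemma enorm_sqr u : enorm u ^+ 2 = dotv u u.
Proof. by rewrite sqr_sqrtr ?dotvv_ge0. Qed.

End Dot_product.

Lemma dotv_trmx {R : realType} (r n : nat) (A : 'M[R]_(r, n)) u x :
  dotv (A^T *m u) x = dotv u (A *m x).
Proof.
have dotvE k (a c : 'cV[R]_k) : dotv a c = (a^T *m c) 0 0.
  by rewrite mxE; apply: eq_bigr => i _; rewrite mxE.
by rewrite !dotvE trmx_mul trmxK mulmxA.
Qed.

(** Let [s] tend to 0. This discards the second-order term in first-order optimality. *)
Lemma ge0_of_affine_ge0 {R : realType} (K M : R) :
  (forall s, 0 < s -> s <= 1 -> 0 <= K + s * M) -> 0 <= K.
Proof.
move=> KM; rewrite leNgt; apply/negP => K_lt0.
(* This [s] makes [K + s |M| = s (K - 1) < 0]. *)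
pose s := - K / (`|M| - K + 1).
have d_gt0 : 0 < `|M| - K + 1 by have := normr_ge0 M; lra.
have s_gt0 : 0 < s by rewrite divr_gt0 ?oppr_gt0.
have s_le1 : s <= 1.
  by rewrite ler_pdivrMr // mul1r; have := normr_ge0 M; lra.
have sd : s * (`|M| - K + 1) = - K by rewrite divfK ?gt_eqF.
have := KM s s_gt0 s_le1; have := ler_norm M; nra.
Qed.

(** * Minimality conditions and conjugate subgradients *)

Section Minimizers.
Context {R : realType}.

(** Properness makes the minimum finite, and points where [f] is [+oo] impose no condition, so
    minimality reduces to real inequalities. *)
Lemma argmin_addP (n : nat) (f : 'cV[R]_n -> \bar R) (phi : 'cV[R]_n -> R) p :
  proper_fun f ->
  argmin (fun x => f x + (phi x)%:E)%E p <->
  exists2 a, f p = a%:E & forall x c, f x = c%:E -> a + phi p <= c + phi x.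
Proof.
move=> [f_gtNy [x0 fx0]]; split => [pmin|[a fp pmin] y].
  have fp_fin : f p \is a fin_num.
    rewrite fin_numElt f_gtNy /=; move: (pmin x0) fx0 (f_gtNy x0).
    by case: (f p) (f x0) => [a||] [c||] //= _ _ _; rewrite ltry.
  exists (fine (f p)); rewrite ?fineK // => x c fx.
  by move: (pmin x); rewrite fx -(fineK fp_fin) -!EFinD lee_fin.
rewrite fp; case E: (f y) (f_gtNy y) => [c||] // _.
  by rewrite -!EFinD lee_fin; apply: pmin.
by rewrite addye // leey.
Qed.

Lemma convex_fun_segment (n : nat) (f : 'cV[R]_n -> \bar R) x p c a (s : R) :
  convex_fun f -> 0 <= s -> s <= 1 -> f x = c%:E -> f p = a%:E ->
  (f (s *: x + (1 - s) *: p)%R <= (s * c + (1 - s) * a)%:E)%E.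
Proof.
move=> f_convex s_ge0 s_le1 fx fp.
have := f_convex (x, c) (p, a) (Itv01 s_ge0 s_le1).
by rewrite !inE /epigraph /= fx fp; apply.
Qed.

(* First-order optimality: the quadratic term may be replaced by its
   linearization at the minimizer. *)
Lemma argmin_augmented_lagrangian (n r : nat) (f : 'cV[R]_n -> \bar R)
    (A : 'M[R]_(r, n)) (t : R) (l a : 'cV[R]_r) p :
  proper_fun f -> convex_fun f ->
  argmin (fun x => f x + (dotv l (A *m x) +
                          t / 2 * enorm (A *m x + a) ^+ 2)%:E)%E p ->
  argmin (fun x => f x + (dotv (l + t *: (A *m p + a)) (A *m x))%:E)%E p.
Proof.
move=> f_proper f_convex /(argmin_addP _ _ f_proper)[fp fpE pmin].
apply/(argmin_addP _ _ f_proper); exists fp => // x c fxE.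
set v := A *m p + a; pose d := A *m x - A *m p.
suff: 0 <= c - fp + dotv l d + t * dotv v d.
  by rewrite /d !dotv_linE; lra.
(* For a step [s] from [p] towards [x], convexity and minimality make [s] times this affine function
   of [s] nonnegative; the penalty contributes [t / 2 * dotv d d] at order [s ^ 2]. *)
apply: (@ge0_of_affine_ge0 _ _ (t / 2 * dotv d d)) => s s_gt0 s_le1.
have := convex_fun_segment f_convex (ltW s_gt0) s_le1 fxE fpE.
set y := s *: x + _; case E: (f y) (f_proper.1 y) => [e||] // _.
rewrite lee_fin => e_le; have := pmin y e E.
have -> : A *m y = A *m p + s *: d.
  rewrite /y /d mulmxDr -!scalemxAr scalerBr scalerBl scale1r.
  by rewrite addrCA addrA.
rewrite addrAC -/v; clearbody v d.
rewrite !enorm_sqr !dotv_linE (dotvC d v) => le_e.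
have : 0 <= s * (c - fp + dotv l d + t * dotv v d + s * (t / 2 * dotv d d)).
  by lra.
by rewrite pmulr_rge0.
Qed.

(** Monotonicity of the subdifferential of [f], with subgradients [- A^T u] at [p] and [- A^T v] at
    [q]: add the two minimality inequalities. *)
Lemma argmin_lagrangian_mono (n r : nat) (f : 'cV[R]_n -> \bar R)
    (A : 'M[R]_(r, n)) (u v : 'cV[R]_r) p q :
  proper_fun f ->
  argmin (fun x => f x + (dotv u (A *m x))%:E)%E p ->
  argmin (fun x => f x + (dotv v (A *m x))%:E)%E q ->
  dotv (v - u) (A *m q - A *m p) <= 0.
Proof.
move=> f_proper /(argmin_addP _ _ f_proper)[a fp pmin].
move=> /(argmin_addP _ _ f_proper)[c fq qmin].
by have := pmin q c fq; have := qmin p a fp; rewrite !dotv_linE; lra.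
Qed.

(* The proximal step from a conjugate subgradient [x] does not move [A x];
   this replaces the Fenchel-Moreau theorem. *)
Lemma conjugate_subgradient_prox (n r : nat) (f : 'cV[R]_n -> \bar R)
    (A : 'M[R]_(r, n)) (t : R) (l : 'cV[R]_r) x p :
  proper_fun f -> 0 < t ->
  subdifferential (conjugate f) (- (A^T *m l)) x ->
  argmin (fun x' =>
    f x' + (dotv (l + t *: (A *m p - A *m x)) (A *m x'))%:E)%E p ->
  A *m p = A *m x.
Proof.
move=> f_proper t_gt0 xsub /(argmin_addP _ _ f_proper)[a fp pmin].
set u := l + _ in pmin.
(* Minimality of [p] makes Fenchel-Young tight at [- A^T u]. *)
have conj_u : (conjugate f (- (A^T *m u)) <= (dotv (- (A^T *m u)) p - a)%:E)%E.
  apply: ge_ereal_sup => _ [x' _ <-].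
  case E: (f x') (f_proper.1 x') => [c||] // _; last by rewrite /= leNye.
  rewrite -EFinB lee_fin !dotvNl !dotv_trmx.
  by have := pmin x' c E; lra.
have conj_l : ((dotv (- (A^T *m l)) p - a)%:E <= conjugate f (- (A^T *m l)))%E.
  by apply: ereal_sup_ubound; exists p; rewrite // fp.
(* The subgradient inequality leaves [<u - l, A p - A x> <= 0], where [u - l = t (A p - A x)]. *)
have := le_trans (leeD2r _ conj_l) (le_trans (xsub _) conj_u).
rewrite -EFinD lee_fin => le0.
suff /dotvv_le0 /eqP : dotv (A *m p - A *m x) (A *m p - A *m x) <= 0.
  by rewrite subr_eq0 => /eqP.
rewrite -(pmulr_rle0 _ t_gt0); move: le0.
rewrite (dotvC x) !dotv_linE !dotv_trmx /u !dotv_linE.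
by rewrite (dotvC (A *m x) (A *m p)); lra.
Qed.

End Minimizers.

(** * ADMM iterations and the dual function *)

Section ADMM_iteration.
Context {R : realType} {n m r : nat}.
Context (f : 'cV[R]_n -> \bar R) (g : 'cV[R]_m -> \bar R).
Context (A : 'M[R]_(r, n)) (B : 'M[R]_(r, m)) (b : 'cV[R]_r).

(** The multiplier involves the old [z], so it differs from the updated one by [t] times the change
    of [B z]. *)
Lemma argmin_x_objective t l z x :
  proper_fun f -> convex_fun f -> argmin (x_objective f A B b t l z) x ->
  argmin (fun x' =>
    f x' + (dotv (l + t *: (A *m x + B *m z - b)) (A *m x'))%:E)%E x.
Proof.
move=> f_proper f_convex xmin; rewrite -addrA.
apply: argmin_augmented_lagrangian => // x'.
by have := xmin x'; rewrite /x_objective -!addeA -!EFinD !addrA.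
Qed.

(** Here the multiplier is exactly the updated one. *)
Lemma argmin_z_objective t l x z :
  proper_fun g -> convex_fun g -> argmin (z_objective g A B b t l x) z ->
  argmin (fun z' =>
    g z' + (dotv (l + t *: (A *m x + B *m z - b)) (B *m z'))%:E)%E z.
Proof.
move=> g_proper g_convex zmin; rewrite (addrC (A *m x)) -addrA.
apply: argmin_augmented_lagrangian => // z'.
have := zmin z'; rewrite /z_objective -!addeA -!EFinD.
by rewrite -!addrA !(addrCA (A *m x)).
Qed.

(** Minimizers need not be unique, so the first iterate is prescribed; attainment and choice supply
    the later ones. *)
Lemma ADMM_sequence_exists t l0 z0 x1 z1 :
  subproblems_attained f g A B b t ->
  argmin (x_objective f A B b t l0 z0) x1 ->
  argmin (z_objective g A B b t l0 x1) z1 ->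
  exists x z lam, [/\ ADMM_sequence f g A B b t x z lam,
    lam 0%N = l0, x 1%N = x1 & z 1%N = z1].
Proof.
move=> [xatt zatt] x1min z1min.
pose step_spec (s s' : 'cV[R]_n * 'cV[R]_m * 'cV[R]_r) :=
  [/\ argmin (x_objective f A B b t s.2 s.1.2) s'.1.1,
      argmin (z_objective g A B b t s.2 s'.1.1) s'.1.2 &
      s'.2 = s.2 + t *: (A *m s'.1.1 + B *m s'.1.2 - b)].
have [step stepP] : {step & forall s, step_spec s (step s)}.
  apply: choice => s; have [x xmin] := xatt s.2 s.1.2.
  have [z zmin] := zatt _ _ _ xmin.
  by exists (x, z, s.2 + t *: (A *m x + B *m z - b)).
pose s1 := (x1, z1, l0 + t *: (A *m x1 + B *m z1 - b)).
pose st k := if k is j.+1 then iter j step s1 else (x1, z0, l0).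
exists (fun k => (st k).1.1), (fun k => (st k).1.2), (fun k => (st k).2).
by split=> // -[|k]; [split | exact: stepP].
Qed.

Lemma dual_le l x z fx gz : f x = fx%:E -> g z = gz%:E ->
  (dual f g A B b l <= (fx + gz + dotv l (A *m x + B *m z - b))%:E)%E.
Proof.
by move=> fxE gzE; apply: ereal_inf_lbound; exists (x, z); rewrite //= fxE gzE.
Qed.

(** The Lagrangian separates in [x] and [z]. With [dual_le], this makes the residual a supergradient
    of the dual at [l]. *)
Lemma dual_argmin l x z : proper_fun f -> proper_fun g ->
  argmin (fun x' => f x' + (dotv l (A *m x'))%:E)%E x ->
  argmin (fun z' => g z' + (dotv l (B *m z'))%:E)%E z ->
  exists fx gz, [/\ f x = fx%:E, g z = gz%:E &
    dual f g A B b l = (fx + gz + dotv l (A *m x + B *m z - b))%:E].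
Proof.
move=> f_proper g_proper /(argmin_addP _ _ f_proper)[fx fxE xmin].
move=> /(argmin_addP _ _ g_proper)[gz gzE zmin].
exists fx, gz; split=> //; apply/le_anti; rewrite dual_le //=.
apply: le_ereal_inf_tmp => _ [[x' z'] _ <-] /=.
case Ef: (f x') (f_proper.1 x') => [c||] // _;
  case Eg: (g z') (g_proper.1 z') => [e||] //= _; rewrite ?leey //.
by rewrite -!EFinD lee_fin; have := xmin _ _ Ef; have := zmin _ _ Eg;
  rewrite !dotv_linE; lra.
Qed.

(* [d] and [e] are the increments of [A x] and [B z] in one ADMM iteration that
   starts with residual [- xi]; the hypotheses come from monotonicity. *)
Lemma residual_le (xi d e : 'cV[R]_r) :
  dotv (d - xi) d <= 0 -> dotv (d + e - xi) e <= 0 ->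
  - dotv xi (d + e - xi) <= dotv xi xi.
Proof.
move=> d_le e_le.
(* The hypotheses add up to [<xi, d + e> >= |d|^2 + <d, e> + |e|^2], which is half of
   [|d|^2 + |e|^2 + |d + e|^2]. *)
have := dotvv_ge0 (d + e); have := dotvv_ge0 d; have := dotvv_ge0 e.
move: d_le e_le; rewrite !dotv_linE.
by rewrite (dotvC e d) (dotvC xi d) (dotvC xi e); lra.
Qed.

End ADMM_iteration.

(** * From the linear rate to the PŁ inequality *)

Theorem theorem7 (R : realType) (n m r : nat)
  (f : 'cV[R]_n -> \bar R) (g : 'cV[R]_m -> \bar R)
  (A : 'M[R]_(r, n)) (B : 'M[R]_(r, m)) (b : 'cV[R]_r)
  (f_closed : closed_fun f) (f_proper : proper_fun f) (f_convex : convex_fun f)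
  (g_closed : closed_fun g) (g_proper : proper_fun g) (g_convex : convex_fun g)
  (A_neq0 : A != 0) (B_neq0 : B != 0)
  (xstar : 'cV[R]_n) (zstar : 'cV[R]_m) (lstar : 'cV[R]_r)
  (opt_star : optimal_solution f g A B b xstar zstar)
  (dual_star : dual_maximizer f g A B b lstar)
  (strong_duality : dual f g A B b lstar = (f xstar + g zstar)%E)
  (t : R) (t_gt0 : 0 < t)
  (attained : subproblems_attained f g A B b t)
  (c1 c2 : R) (c1_ge0 : 0 <= c1) (c2_ge0 : 0 <= c2)
  (fF : F_class A c1 f) (gF : F_class B c2 g) :
  dual_linear_convergence f g A B b t lstar ->
  PL_inequality f g A B b lstar.
Proof.
move=> [gamma [gamma_ge0 gamma_lt1 conv_rate]].
have og_gt0 : 0 < 1 - gamma by rewrite subr_gt0.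
exists ((1 - gamma) / (2 * t)); first by rewrite divr_gt0 ?mulr_gt0.
move=> l _ [xbar xbar_sub [zbar zbar_sub <-]].
set xi := b - _ - _; pose l0 := l + t *: xi.
have [x1 x1min] := attained.1 l0 zbar.
have [z1 z1min] := attained.2 _ _ _ x1min.
have x1opt := argmin_x_objective f_proper f_convex x1min.
have z1opt := argmin_z_objective g_proper g_convex z1min.
(* By the choice of [l0], the multiplier in [x1opt] is [l + t (A x1 - A xbar)]; likewise for [z1]
   once [A x1] is known. *)
have Ax1 : A *m x1 = A *m xbar.
  apply: (conjugate_subgradient_prox f_proper t_gt0 xbar_sub).
  congr (argmin _ _): x1opt; apply/funext => x'.
  congr (_ + (dotv _ _)%:E)%E; rewrite /l0 -addrA -scalerDr; congr (_ + _ *: _).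
  by apply/matrixP => i j; rewrite !mxE; ring.
have Bz1 : B *m z1 = B *m zbar.
  apply: (conjugate_subgradient_prox g_proper t_gt0 zbar_sub).
  congr (argmin _ _): z1opt; apply/funext => z'.
  congr (_ + (dotv _ _)%:E)%E; rewrite /l0 -addrA -scalerDr Ax1.
  by congr (_ + _ *: _); apply/matrixP => i j; rewrite !mxE; ring.
have res1 : A *m x1 + B *m z1 - b = - xi.
  by rewrite Ax1 Bz1 /xi !opprB addrCA addrA.
have l1E : l0 + t *: (A *m x1 + B *m z1 - b) = l.
  by rewrite res1 scalerN addrK.
(* Both [x1] and [z1] now minimize the Lagrangian at [l] itself, so the dual is finite there. *)
rewrite -Bz1 l1E in x1opt; rewrite l1E in z1opt.
have [fx [gz [fxE gzE dual_l]]] :=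
  dual_argmin b f_proper g_proper x1opt z1opt.
have [x [z [lam [seqP lam0 x1E z1E]]]] :=
  ADMM_sequence_exists attained x1min z1min.
have lam1 : lam 1%N = l by have [_ _ ->] := seqP 0%N; rewrite lam0 x1E z1E l1E.
have [x2min z2min lam2] := seqP 1%N.
(* The rate is available only from index 1 on, hence the detour through [l0] to get [lam 1 = l]. *)
have := conv_rate x z lam seqP 1%N isT.
rewrite lam1 z1E in x2min z2min lam2 *.
pose d := A *m x 2 - A *m x1; pose e := B *m z 2 - B *m z1.
have res2 : A *m x 2 + B *m z 2 - b = d + e - xi.
  by rewrite -res1 /d /e; apply/matrixP => i j; rewrite !mxE; ring.
(* The second [x]-step has multiplier [l + t (d - xi)], the second [z]-step [l + t (d + e - xi)]. *)
have d_le : dotv (d - xi) d <= 0.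
  have := argmin_lagrangian_mono f_proper x1opt
    (argmin_x_objective f_proper f_convex x2min).
  rewrite addrC addKr dotvZl pmulr_rle0 //.
  congr (dotv _ _ <= 0); rewrite -res1 /d.
  by apply/matrixP => i j; rewrite !mxE; ring.
have e_le : dotv (d + e - xi) e <= 0.
  have := argmin_lagrangian_mono g_proper z1opt
    (argmin_z_objective g_proper g_convex z2min).
  by rewrite addrC addKr dotvZl pmulr_rle0 // res2.
move: (d + e - xi) res2 (residual_le d_le e_le) => eta res2 step_le.
have dual_star_ub := dual_le A B b lstar fxE gzE.
have := dual_le A B b (lam 2) fxE gzE; have := dual_star l.
rewrite lam2 res2 dual_l res1.
(* Both dual values are finite: [dual_le] excludes [+oo]; maximality at [lstar] and the rate at
   [lam 2] exclude [-oo]. *)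
case: (dual f g A B b lstar) dual_star_ub => [D||] // _ _.
case: (dual f g A B b _) => [D2||] //.
rewrite lee_fin -!EFinB -!EFinM !lee_fin enorm_sqr => D2_le rate.
have -> : 1 / (2 * ((1 - gamma) / (2 * t))) = t / (1 - gamma).
  by field; rewrite !gt_eqF.
rewrite mulrAC ler_pdivlMr //; move: D2_le rate.
rewrite (dotvC xi) in step_le.
rewrite dotvDl dotvZl !dotvNr.
have := ler_wpM2l (ltW t_gt0) step_le.
lra.
Qed.
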